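(* Let $n\ge3$ and let $\sigma_1,\dots,\sigma_{n-2}$ be pairwise distinct critical $1$-cells of $(C\Omega_n,W)$, of the form $\sigma_i=(\emptyset,\emptyset,\emptyset,\emptyset,v_i,\emptyset,Z_i,w_i)$ for $1\le i\le n-2$. Put $D=\{w_1,\dots,w_{n-2}\}$ and let $A$ and $C$ be the two one-element sets with $A\cup C=\{1,\dots,n\}\setminus D$. Then, identifying critical cells with the cohomology classes of their duals in $H^{*}(C\Omega_n;\mathbb{Z}_2)$, $$\sigma_1\smile\dots\smile\sigma_{n-2}=(\emptyset,\emptyset,\emptyset,\emptyset,A,\emptyset,C,D)+(\emptyset,\emptyset,\emptyset,\emptyset,C,\emptyset,A,D).$$
   Context: Coefficients are in $\mathbb{Z}_2$. One-element sets $\{v\}$ are written $v$. The complex $C\Omega_n$ ($n\ge3$): a cell is a tuple $\sigma=(x_1,y_1,x_2,y_2,x_3,y_3,x_4,y_4)$ of pairwise disjoint subsets of $\{1,\dots,n\}$ with union $\{1,\dots,n\}$ and $x_3\ne\emptyset\ne x_4$; its dimension is $\sum_i|y_i|$. We write $x_i(\sigma),y_i(\sigma)$ for the entries. The boundary is the sum, over all $i$ and all $v\in y_i$, of the cell obtained by moving $v$ from $y_i$ to $x_i$ plus the cell obtained by moving $v$ from $y_i$ to $x_{i+1}$ (indices mod 4). (Geometrically: $n$ labelled points on the cycle graph $C_4$ with vertices $1,2,3,4$; $x_i$ are the points located at vertex $i$ and $y_i$ those on the edge from $i$ to $i+1$; vertices 3 and 4 must be occupied. So $C\Omega_n$ is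 a regular cubical complex structure on the space of tuples in $(S^1)^n$ whose entries include two fixed points.) The matching $W$ on the cells of $C\Omega_n$ consists of pairs $(\nu,W(\nu))$ with $\nu$ a codimension-one face of $W(\nu)$. Put $\alpha_i(\nu)=\min(x_i(\nu)\cup y_i(\nu))$ for $i=1,2,3$ and $\beta(\nu)=\max(y_3(\nu)\cup x_4(\nu))$. (1) If $x_1(\nu)\cup y_1(\nu)\neq\emptyset$: $\nu$ with $\alpha_1(\nu)\in x_1(\nu)$ is paired with the cell $W(\nu)$ obtained by moving $\alpha_1(\nu)$ from $x_1$ to $y_1$. (2) If $x_1=y_1=\emptyset$ and $x_2\cup y_2\ne\emptyset$: the same rule with $\alpha_2$, moving from $x_2$ to $y_2$. (3) If $x_1=y_1=x_2=y_2=\emptyset$ (Kozlov's matching $\mathcal M$): (3a) if $\alpha_3(\nu)\in x_3(\nu)$ and $|x_3(\nu)|\ge2$, $\nu$ is paired with the cell $W(\nu)$ obtained by moving $\alpha_3(\nu)$ from $x_3$ to $y_3$; (3b) if $x_3(\nu)=\{\alpha_3(\nu)\}$, $\beta(\nu)\in x_4(\nu)$, $|x_4(\nu)|\ge 2$ and $\beta(\nu)>\alpha_3(\nu)$, $\nu$ is paired with the cell $W(\nu)$ obtained by moving $\beta(\nu)$ from $x_4$ to $y_3$. Cells in no pair are critical. They are the cells with $x_1=y_1=x_2=y_2=\emptyset$, $x_3=\{\alpha_3\}$ and one of: $y_3=\emptyset$, $|x_4|\ge2$, $\beta<\alpha_3$; or $y_3=\emptyset$, $x_4=\{\beta\}$;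 or $y_3\neq\emptyset$, $x_4=\{\beta\}$, $\alpha_3<v<\beta$ for all $v\in y_3$. Cohomology classes: an upper $W$-path from a $k$-cell $\tau$ to a $k$-cell $\sigma$ is a sequence $\tau=\tau_1,\dots,\tau_q=\sigma$ ($q\ge1$) of $k$-cells with $\tau_i\ne\tau_{i+1}$, each $\tau_i$ ($i<q$) being the lower member of a pair of $W$ and $\tau_{i+1}$ a face of $W(\tau_i)$. For a critical $k$-cell $\sigma$, ''the cohomology class of the dual of $\sigma$'' is the class in $H^k(C\Omega_n;\mathbb{Z}_2)$ of the cubical cocycle $\sum_\tau N(\tau,\sigma)\,\tau^*$, where $\tau$ runs over all $k$-cells, $\tau^*$ is the dual cochain and $N(\tau,\sigma)$ is the number mod 2 of upper $W$-paths from $\tau$ to $\sigma$ (this is the image of $\sigma$ under the isomorphism from Morse cohomology to cubical cohomology; the Morse differential vanishes, so these classes form a basis).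
   Formalization: The formal theorem assumes n ≥ 4 instead of n ≥ 3: for n = 3 the product is the single class σ₁, which is itself one of the two linearly independent summands on the right, so the stated identity fails there. *)

(* Defs.v *)
From HB Require Import structures.
From mathcomp Require Import all_boot all_algebra.
Set Implicit Arguments.
Unset Strict Implicit.
Unset Printing Implicit Defensive.
Import GRing.Theory.
Local Open Scope quotient_scope.
Local Open Scope ring_scope.

(* The labels 1, ..., n are the elements of 'I_n. The tuple
   (x_1,y_1,...,x_4,y_4) is read cyclically: even positions are the vertices
   of C_4, odd positions its edges, so that x_(i+1) follows y_i, mod 8.
   X i and Y i are the positions of x_i and y_i, for i = 1, ..., 4. *)
Definition X (i : nat) : nat := i.-1.*2.
Definition Y (i : nat) : nat := i.-1.*2.+1.

Definition xset n (i : nat) (t : 8.-tuple {set 'I_n}) : {set 'I_n} :=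
  nth set0 t (X i).
Definition yset n (i : nat) (t : 8.-tuple {set 'I_n}) : {set 'I_n} :=
  nth set0 t (Y i).

Definition is_cell n (t : 8.-tuple {set 'I_n}) : bool :=
  [&& [forall i, forall j, (i != j) ==> [disjoint tnth t i & tnth t j]],
      \bigcup_(i < 8) tnth t i == [set: 'I_n],
      xset 3 t != set0 & xset 4 t != set0].

Record cell (n : nat) := Cell {
  entries :> 8.-tuple {set 'I_n};
  entriesP : is_cell entries }.
HB.instance Definition _ n := [isSub for @entries n].
HB.instance Definition _ n := [Finite of cell n by <:].

Definition cell_dim n (s : cell n) : nat := (\sum_(1 <= i < 5) #|yset i s|)%N.

Definition edges n (t : 8.-tuple {set 'I_n}) : {set 'I_n} :=
  \bigcup_(j < 8 | odd j) tnth t j.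

(* All labels of U lying on an edge move to the start, resp. end, of it. *)
Definition back_tuple n (U : {set 'I_n}) (t : 8.-tuple {set 'I_n}) :
    8.-tuple {set 'I_n} :=
  [tuple if odd j then tnth t j :\: U
         else tnth t j :|: (U :&: tnth t (ordS j)) | j < 8].
Definition fwd_tuple n (U : {set 'I_n}) (t : 8.-tuple {set 'I_n}) :
    8.-tuple {set 'I_n} :=
  [tuple if odd j then tnth t j :\: U
         else tnth t j :|: (U :&: tnth t (ord_pred j)) | j < 8].

Lemma is_cellP n (t : 8.-tuple {set 'I_n}) :
  reflect [/\ exists f : 'I_n -> 'I_8, forall j v, (v \in tnth t j) = (f v == j),
              xset 3 t != set0 & xset 4 t != set0] (is_cell t).
Proof.
apply: (iffP and4P) => [[/forallP H /eqP U h3 h4]|[[f Hf] h3 h4]].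
  split=> //.
  have Hv v : exists j, v \in tnth t j.
    have: v \in \bigcup_(i < 8) tnth t i by rewrite U in_setT.
    by case/bigcupP=> j _ vj; exists j.
  exists (fun v => xchoose (Hv v)) => j v.
  have vj := xchooseP (Hv v).
  apply/idP/eqP => [vin|<- //]; apply/eqP; apply: contraT => neq.
  have /forallP /(_ j) /implyP /(_ neq) := H (xchoose (Hv v)).
  by move/disjoint_setI0/setP/(_ v); rewrite !inE vj vin.
split=> //.
  apply/forallP=> i; apply/forallP=> j; apply/implyP=> neq.
  rewrite -setI_eq0; apply/eqP/setP=> v; rewrite !inE !Hf.
  by apply/negP=> /andP[/eqP fi /eqP fj]; rewrite -fi -fj eqxx in neq.
by apply/eqP/setP=> v; rewrite in_setT; apply/bigcupP; exists (f v); rewrite // Hf.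
Qed.

Lemma entry_tnth n (t : 8.-tuple {set 'I_n}) (j : 'I_8) :
  nth set0 t j = tnth t j.
Proof. by rewrite (tnth_nth set0). Qed.

Lemma ord8_all (P : pred 'I_8) :
  P (inord 0) -> P (inord 1) -> P (inord 2) -> P (inord 3) -> P (inord 4) ->
  P (inord 5) -> P (inord 6) -> P (inord 7) -> forall j, P j.
Proof.
move=> ? ? ? ? ? ? ? ? [j lj].
have -> : Ordinal lj = inord j by apply: val_inj; rewrite /= inordK.
by do 8 (case: j lj => [//|j] lj).
Qed.

Lemma odd_ordS (j : 'I_8) : odd (ordS j) = ~~ odd j.
Proof. by apply/eqP; move: j; apply: ord8_all; rewrite /= !inordK. Qed.
Lemma odd_ord_pred (j : 'I_8) : odd (ord_pred j) = ~~ odd j.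
Proof. by apply/eqP; move: j; apply: ord8_all; rewrite /= !inordK. Qed.

Lemma back_is_cell n (U : {set 'I_n}) (s : cell n) : is_cell (back_tuple U s).
Proof.
have /is_cellP [[f Hf] h3 h4] := entriesP s.
have sub (j : 'I_8) : ~~ odd j -> tnth s j != set0 ->
    tnth (back_tuple U s) j != set0.
  move=> /negPf oj /set0Pn[v vj]; apply/set0Pn; exists v.
  by rewrite tnth_mktuple oj !inE vj.
apply/is_cellP; split.
- exists (fun v => if (v \in U) && odd (f v) then ord_pred (f v) else f v) => j v.
  rewrite tnth_mktuple; case: ifP => oj; rewrite !inE !Hf.
    case: ifP => [/andP[vU of_]|/negbT]; last first.
      rewrite negb_and; case/orP => [->//|of_].
      by case: eqP => [E|]; rewrite ?andbF //; rewrite E oj in of_.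
    rewrite vU /=; apply/esym/eqP => E.
    by move: (odd_ord_pred (f v)); rewrite E oj of_.
  case vU: (v \in U); rewrite ?andFb ?orbF //=.
  have [E|NE] := eqVneq (f v) j; first by rewrite E oj eqxx.
  rewrite /=; case: ifP => of_.
    by apply/eqP/eqP => [->|<-]; rewrite ?ordSK ?ord_predK.
  rewrite (negPf NE); apply/eqP => E.
  by move: (odd_ordS j); rewrite -E of_ oj.
- rewrite /xset (entry_tnth _ (@Ordinal 8 4 isT)); apply: sub => //.
  by rewrite -entry_tnth.
- rewrite /xset (entry_tnth _ (@Ordinal 8 6 isT)); apply: sub => //.
  by rewrite -entry_tnth.
Qed.

Lemma fwd_is_cell n (U : {set 'I_n}) (s : cell n) : is_cell (fwd_tuple U s).
Proof.
have /is_cellP [[f Hf] h3 h4] := entriesP s.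
have sub (j : 'I_8) : ~~ odd j -> tnth s j != set0 ->
    tnth (fwd_tuple U s) j != set0.
  move=> /negPf oj /set0Pn[v vj]; apply/set0Pn; exists v.
  by rewrite tnth_mktuple oj !inE vj.
apply/is_cellP; split.
- exists (fun v => if (v \in U) && odd (f v) then ordS (f v) else f v) => j v.
  rewrite tnth_mktuple; case: ifP => oj; rewrite !inE !Hf.
    case: ifP => [/andP[vU of_]|/negbT]; last first.
      rewrite negb_and; case/orP => [->//|of_].
      by case: eqP => [E|]; rewrite ?andbF //; rewrite E oj in of_.
    rewrite vU /=; apply/esym/eqP => E.
    by move: (odd_ordS (f v)); rewrite E oj of_.
  case vU: (v \in U); rewrite ?andFb ?orbF //=.
  have [E|NE] := eqVneq (f v) j; first by rewrite E oj eqxx.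
  rewrite /=; case: ifP => of_.
    by apply/eqP/eqP => [->|<-]; rewrite ?ordSK ?ord_predK.
  rewrite (negPf NE); apply/eqP => E.
  by move: (odd_ord_pred j); rewrite -E of_ oj.
- rewrite /xset (entry_tnth _ (@Ordinal 8 4 isT)); apply: sub => //.
  by rewrite -entry_tnth.
- rewrite /xset (entry_tnth _ (@Ordinal 8 6 isT)); apply: sub => //.
  by rewrite -entry_tnth.
Qed.

Definition back n (U : {set 'I_n}) (s : cell n) : cell n :=
  Cell (back_is_cell U s).
Definition fwd n (U : {set 'I_n}) (s : cell n) : cell n :=
  Cell (fwd_is_cell U s).

Definition face n (t s : cell n) : bool :=
  [exists v in edges s, (t == back [set v] s) || (t == fwd [set v] s)].

Section FaceTheory.
Variable n : nat.
Implicit Types (s t : cell n) (U V : {set 'I_n}).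

Lemma mem_edges s j v : v \in tnth s j -> (v \in edges s) = odd j.
Proof.
have /is_cellP [[f Hf] _ _] := entriesP s.
rewrite Hf => /eqP fv; apply/bigcupP/idP => [[i oi]|oj].
  by rewrite Hf fv => /eqP ->.
by exists j; rewrite // Hf fv.
Qed.

Lemma cell_eqP s t :
  (forall j, tnth s j = tnth t j) -> s = t.
Proof. by move=> H; apply/val_inj/eq_from_tnth. Qed.

Lemma edges_back U s : edges (back U s) = edges s :\: U.
Proof.
apply/setP=> v; apply/bigcupP/setDP.
  case=> j oj; rewrite tnth_mktuple oj => /setDP[vj vU]; split=> //.
  by apply/bigcupP; exists j.
case=> /bigcupP[j oj vj] vU; exists j => //.
by rewrite tnth_mktuple oj; apply/setDP.
Qed.

Lemma edges_fwd U s : edges (fwd U s) = edges s :\: U.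
Proof.
apply/setP=> v; apply/bigcupP/setDP.
  case=> j oj; rewrite tnth_mktuple oj => /setDP[vj vU]; split=> //.
  by apply/bigcupP; exists j.
case=> /bigcupP[j oj vj] vU; exists j => //.
by rewrite tnth_mktuple oj; apply/setDP.
Qed.

Lemma back_back U V s : back U (back V s) = back (U :|: V) s.
Proof.
apply: cell_eqP => j; rewrite !tnth_mktuple odd_ordS.
case: (odd j) => /=; apply/setP=> v; rewrite !inE.
  by rewrite negb_or andbA.
by case: (v \in U); case: (v \in V); case: (v \in tnth s j);
   case: (v \in tnth s (ordS j)).
Qed.

Lemma fwd_fwd U V s : fwd U (fwd V s) = fwd (U :|: V) s.
Proof.
apply: cell_eqP => j; rewrite !tnth_mktuple odd_ord_pred.
case: (odd j) => /=; apply/setP=> v; rewrite !inE.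
  by rewrite negb_or andbA.
by case: (v \in U); case: (v \in V); case: (v \in tnth s j);
   case: (v \in tnth s (ord_pred j)).
Qed.

Lemma back_fwd U V s : [disjoint U & V] ->
  back U (fwd V s) = fwd V (back U s).
Proof.
move=> dUV; apply: cell_eqP => j; rewrite !tnth_mktuple odd_ordS odd_ord_pred.
case: (odd j) => /=; apply/setP=> v; rewrite !inE; first by rewrite andbCA.
have : ~~ ((v \in U) && (v \in V)).
  by apply/negP=> /andP[vU vV]; rewrite (disjointFr dUV vU) in vV.
by case: (v \in U); case: (v \in V); case: (v \in tnth s j);
   case: (v \in tnth s (ord_pred j)); case: (v \in tnth s (ordS j)).
Qed.

Lemma back0 s : back set0 s = s.
Proof.
apply: cell_eqP => j; rewrite !tnth_mktuple set0I setU0 setD0.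
by case: ifP.
Qed.

Lemma fwd0 s : fwd set0 s = s.
Proof.
apply: cell_eqP => j; rewrite !tnth_mktuple set0I setU0 setD0.
by case: ifP.
Qed.

End FaceTheory.

(* Cochains of all degrees together; the cell complex is finite. *)
Definition cochain (n : nat) := {ffun cell n -> 'F_2}.
HB.instance Definition _ n := Finite.on (cochain n).
HB.instance Definition _ n := GRing.Zmodule.on (cochain n).

Definition coboundary n (c : cochain n) : cochain n :=
  [ffun s : cell n =>
     \sum_(v in edges s) (c (back [set v] s) + c (fwd [set v] s))].

(* Serre's cubical cup product, every edge of C_4 being oriented from i to
   i+1: the first factor takes the initial face in the directions outside U,
   the second one the terminal face in the directions of U. *)
Definition cup n (a b : cochain n) : cochain n :=
  [ffun s : cell n => \sum_(U : {set 'I_n} | U \subset edges s)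
     a (back (edges s :\: U) s) * b (fwd U s)].

Definition cochain1 n : cochain n := [ffun s : cell n => (edges s == set0)%:R].

Section CochainRing.
Variable n : nat.
Implicit Types a b c : cochain n.

Lemma cup1l : left_id (cochain1 n) (@cup n).
Proof.
move=> a; apply/ffunP=> s; rewrite ffunE (bigD1 set0) ?sub0set //= big1.
  by rewrite !ffunE edges_back setD0 setDv eqxx mul1r fwd0 addr0.
move=> U /andP[UE U0]; rewrite ffunE edges_back setDDr setDv set0U.
by rewrite (setIidPr UE) (negPf U0) mul0r.
Qed.

Lemma cup1r : right_id (cochain1 n) (@cup n).
Proof.
move=> a; apply/ffunP=> s; rewrite ffunE (bigD1 (edges s)) //= big1.
  by rewrite !ffunE edges_fwd !setDv eqxx mulr1 back0 addr0.
move=> U /andP[UE UnE]; rewrite ffunE edges_fwd.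
suff /negPf-> : edges s :\: U != set0 by rewrite mulr0.
by apply: contra UnE; rewrite setD_eq0 eqEsubset UE.
Qed.

Lemma cupA : associative (@cup n).
Proof.
move=> a b c; apply/ffunP=> s; set E := edges s.
transitivity (\sum_(V : {set 'I_n} | V \subset E)
   \sum_(U : {set 'I_n} | (V \subset U) && (U \subset E))
     a (back (E :\: V) s) * b (fwd V (back (E :\: U) s)) * c (fwd U s)).
  rewrite ffunE; apply: eq_bigr => V VE; rewrite ffunE edges_fwd -/E mulr_sumr.
  rewrite [RHS](reindex_onto (fun T : {set 'I_n} => V :|: T) (fun U => U :\: V)) /=;
    last by move=> U /andP[VU _]; rewrite -{1}(setIidPr VU) setID.
  apply: eq_big => [T|T TE].
    rewrite subsetUl subUset VE /= setDUl setDv set0U subsetD.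
    by congr andb; apply/idP/eqP => /setDidPl.
  rewrite mulrA fwd_fwd [T :|: V]setUC setDDl back_fwd //.
  by rewrite disjoint_sym disjoints_subset setCD subsetU // subsetUl orbT.
rewrite (exchange_big_dep (fun U : {set 'I_n} => U \subset E)) /=;
  last by move=> V U _ /andP[].
rewrite ffunE; apply: eq_bigr => U UE.
rewrite ffunE edges_back -/E setDDr setDv set0U (setIidPr UE) mulr_suml.
apply: eq_big => [V|V /andP[_ /andP[VU _]]].
  by rewrite UE andbT; case VU: (V \subset U); rewrite ?andbF // (subset_trans VU UE).
rewrite back_back; congr (a (back _ s) * _ * _).
apply/setP=> v; rewrite !inE; move/subsetP/(_ v): VU; move/subsetP/(_ v): UE.
by case: (v \in U); case: (v \in V); case: (v \in E) => //= h1 h2;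
   (have := h1 isT) || (have := h2 isT).
Qed.

Lemma cupDl : left_distributive (@cup n) +%R.
Proof.
move=> a b c; apply/ffunP=> s; rewrite !ffunE -big_split /=.
by apply: eq_bigr => U _; rewrite ffunE mulrDl.
Qed.

Lemma cupDr : right_distributive (@cup n) +%R.
Proof.
move=> a b c; apply/ffunP=> s; rewrite !ffunE -big_split /=.
by apply: eq_bigr => U _; rewrite ffunE mulrDr.
Qed.

End CochainRing.

HB.instance Definition _ n := GRing.Zmodule_isPzRing.Build (cochain n)
  (@cupA n) (@cup1l n) (@cup1r n) (@cupDl n) (@cupDr n).

Section Leibniz.
Variable n : nat.
Implicit Types a b c : cochain n.

Let addF2 (x : 'F_2) : x + x = 0.
Proof. by apply: addrr_pchar2; rewrite pchar_Fp. Qed.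

Lemma coboundary_is_zmod_morphism : zmod_morphism (@coboundary n).
Proof.
move=> a b; apply/ffunP=> s; rewrite !ffunE -sumrB.
by apply: eq_bigr => v _; rewrite !ffunE opprD addrACA.
Qed.
HB.instance Definition _ :=
  GRing.isZmodMorphism.Build _ _ (@coboundary n) coboundary_is_zmod_morphism.

Lemma coboundary1 : coboundary (1 : cochain n) = 0.
Proof.
apply/ffunP=> s; rewrite !ffunE big1 // => v _.
by rewrite !ffunE edges_back edges_fwd addF2.
Qed.

Lemma coboundary_coboundary a : coboundary (coboundary a) = 0.
Proof.
apply/ffunP=> s; rewrite [RHS]ffunE ffunE; set E := edges s.
pose F (v w : 'I_n) := a (back [set w] (back [set v] s))
  + a (fwd [set w] (back [set v] s)) + (a (back [set w] (fwd [set v] s))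
  + a (fwd [set w] (fwd [set v] s))).
have FC v w : v != w -> F v w = F w v.
  move=> vw; have d x y : x != y -> [disjoint [set x : 'I_n] & [set y]].
    by move=> xy; rewrite disjoints1 inE.
  rewrite /F !back_back !fwd_fwd -!back_fwd ?d //; last by rewrite eq_sym.
  by rewrite [_ |: [set v]]setUC addrACA [X in _ + X]addrC addrACA.
transitivity (\sum_(v in E) \sum_(w in E | w != v) F v w).
  apply: eq_bigr => v vE; rewrite !ffunE edges_back edges_fwd -/E -big_split.
  by apply: eq_bigl => w; rewrite !inE andbC.
transitivity (\sum_(v in E) \sum_(w in E | (w < v)%N) (F v w + F w v)).
  transitivity (\sum_(v in E) (\sum_(w in E | (w < v)%N) F v w +
                               \sum_(w in E | (v < w)%N) F v w)).
    apply: eq_bigr => v vE; rewrite (bigID (fun w : 'I_n => (w < v)%N)) /=.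
    congr +%R; apply: eq_bigl => w; rewrite -andbA; congr andb.
      by rewrite -val_eqE /= neq_ltn; case: ltngtP.
    by rewrite -val_eqE /= neq_ltn; case: ltngtP.
  rewrite big_split /= [X in _ + X](exchange_big_dep (fun w => w \in E)) /=;
    last by move=> v w _ /andP[].
  rewrite -big_split; apply: eq_bigr => v vE; rewrite [RHS]big_split /=.
  by congr +%R; apply: eq_bigl => w; rewrite vE.
rewrite big1 // => v _; rewrite big1 // => w /andP[_ wv].
by rewrite FC ?addF2 //; apply: contraTneq wv => ->; rewrite ltnn.
Qed.

Lemma coboundaryM a b :
  coboundary (a * b) = coboundary a * b + a * coboundary b.
Proof.
apply/ffunP=> s; rewrite [RHS]ffunE; set E := edges s.
pose A (v : 'I_n) (U : {set 'I_n}) :=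
  a (back (E :\: U) s) * b (fwd U (back [set v] s)).
pose B (v : 'I_n) (U : {set 'I_n}) :=
  a (back (E :\ v :\: U) (fwd [set v] s)) * b (fwd (v |: U) s).
pose C (v : 'I_n) (U : {set 'I_n}) :=
  a (back (E :\: U) s) * b (fwd (v |: U) s).
pose S (F : 'I_n -> {set 'I_n} -> 'F_2) :=
  \sum_(v in E) \sum_(U : {set 'I_n} | U \subset E :\ v) F v U.
have vN v (U : {set 'I_n}) : U \subset E :\ v -> v \notin U.
  by move=> UE; apply/negP=> /(subsetP UE); rewrite !inE eqxx.
have vEU v (U : {set 'I_n}) : v \in E -> U \subset E :\ v ->
    v |: (E :\ v :\: U) = E :\: U.
  move=> vE UE; apply/setP=> w; rewrite !inE.
  by have [->|] //= := eqVneq w v; rewrite vE (vN _ _ UE).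
have -> : coboundary (a * b) s = S A + S B.
  rewrite ffunE -big_split; apply: eq_bigr => v vE /=.
  rewrite !ffunE edges_back edges_fwd -/E.
  congr (_ + _); apply: eq_bigr => U UE.
    by rewrite back_back setUC vEU.
  by rewrite fwd_fwd /B setUC.
have -> : (coboundary a * b) s = S C + S B.
  rewrite ffunE -/E /S -big_split /=.
  transitivity (\sum_(v in E) \sum_(U : {set 'I_n} | (v \in U) && (U \subset E))
     (a (back [set v] (back (E :\: U) s)) + a (fwd [set v] (back (E :\: U) s)))
       * b (fwd U s)).
    rewrite (exchange_big_dep (fun U : {set 'I_n} => U \subset E)) /=;
      last by move=> v U _ /andP[].
    apply: eq_bigr => U UE; rewrite ffunE edges_back -/E setDDr setDv set0U.
    rewrite (setIidPr UE) mulr_suml; apply: eq_bigl => v.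
    by rewrite UE andbT; case vU: (v \in U); rewrite ?andbF // (subsetP UE).
  apply: eq_bigr => v vE; rewrite -big_split /=.
  rewrite (reindex_onto (fun U : {set 'I_n} => v |: U) (fun U => U :\ v)) /=;
    last by move=> U /andP[vU _]; rewrite setD1K.
  apply: eq_big => [U|U /andP[/andP[_ UE] /eqP vU]].
    rewrite setU11 subUset sub1set vE /= subsetD1; congr andb.
    by apply/eqP/idP => [<-|/setU1K //]; rewrite !inE eqxx.
  have UE' : U \subset E :\ v by rewrite -vU setSD.
  have EvU : E :\: (v |: U) = E :\ v :\: U by rewrite setDDl.
  rewrite EvU back_back vEU // -back_fwd ?mulrDl //.
  by rewrite disjoint_sym disjoints1 !inE eqxx andbF.
have -> : (a * coboundary b) s = S A + S C.
  rewrite ffunE -/E /S -big_split /=.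
  transitivity (\sum_(v in E) \sum_(U : {set 'I_n} | U \subset E :\ v)
     a (back (E :\: U) s) *
     (b (back [set v] (fwd U s)) + b (fwd [set v] (fwd U s)))).
    rewrite (exchange_big_dep (fun U : {set 'I_n} => U \subset E)) /=;
      last by move=> v U _; rewrite subsetD1 => /andP[].
    apply: eq_bigr => U UE; rewrite ffunE edges_fwd -/E mulr_sumr.
    by apply: eq_bigl => v; rewrite subsetD1 UE inE andbC.
  apply: eq_bigr => v vE; rewrite -big_split; apply: eq_bigr => U UE /=.
  by rewrite fwd_fwd back_fwd ?mulrDr // disjoints1 vN.
by rewrite [S C + _]addrC [S A + S C]addrC -addrA (addrA (S C)) addF2 add0r addrC.
Qed.

End Leibniz.

Definition cocycle_pred n : pred (cochain n) := [pred c | coboundary c == 0].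

Lemma cocycle_subring n : subring_closed (@cocycle_pred n).
Proof.
split=> [|a b|a b]; rewrite !unfold_in ?coboundary1 // => /eqP da /eqP db.
  by rewrite raddfB /= da db subrr.
by rewrite coboundaryM da db mul0r mulr0 addr0.
Qed.
HB.instance Definition _ n :=
  GRing.isSubringClosed.Build (cochain n) (@cocycle_pred n) (@cocycle_subring n).

Record cocycle (n : nat) := Cocycle {
  cocycle_val :> cochain n;
  cocycleP : cocycle_pred cocycle_val }.
HB.instance Definition _ n := [isSub for @cocycle_val n].
HB.instance Definition _ n := [Choice of cocycle n by <:].
HB.instance Definition _ n := GRing.SubChoice_isSubPzRing.Build
  (cochain n) (@cocycle_pred n) (cocycle n) (@cocycle_subring n).

Definition coboundary_pred n : pred (cocycle n) :=
  [pred z | [exists b : cochain n, val z == coboundary b]].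

Lemma coboundary_zmod n : zmod_closed (@coboundary_pred n).
Proof.
split=> [|y z /existsP[a /eqP ya] /existsP[b /eqP zb]]; apply/existsP.
  by exists 0; rewrite !raddf0.
by exists (a - b); rewrite !raddfB /= -ya -zb.
Qed.
HB.instance Definition _ n :=
  GRing.isZmodClosed.Build (cocycle n) (@coboundary_pred n) (@coboundary_zmod n).

(* H^* = ker d / im d, the sum of the H^k over all degrees k. *)
Definition cohomology (n : nat) :=
  {ideal_quot (GRing.ZmodClosed.clone (cocycle n) (@coboundary_pred n) _)}.
HB.instance Definition _ n := GRing.Zmodule.on (cohomology n).
HB.instance Definition _ n := EqQuotient.on (cohomology n).

Definition cohom_one n : cohomology n := \pi_(cohomology n) 1.
Definition cohom_mul n (x y : cohomology n) : cohomology n :=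
  \pi_(cohomology n) (repr x * repr y).

Section CohomologyRing.
Variable n : nat.
Implicit Types (x y z : cocycle n) (p q r : cohomology n).

Lemma cohom_eqP x y :
  reflect (exists b, val x - val y = coboundary b)
          (x == y %[mod cohomology n]).
Proof.
rewrite -Quotient.idealrBE.
apply: (iffP existsP) => -[b bP]; exists b.
  by rewrite -raddfB; apply/eqP.
by rewrite raddfB; apply/eqP.
Qed.

Lemma pi_cohom_mul x y :
  cohom_mul (\pi_(cohomology n) x) (\pi_(cohomology n) y)
  = \pi_(cohomology n) (x * y).
Proof.
apply/eqP/cohom_eqP; set x' := repr _; set y' := repr _.
have /cohom_eqP [a xa] : x' == x %[mod cohomology n] by rewrite reprK.
have /cohom_eqP [b yb] : y' == y %[mod cohomology n] by rewrite reprK.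
have /eqP dx : coboundary (val x) == 0 := cocycleP x.
have /eqP dy' : coboundary (val y') == 0 := cocycleP y'.
exists (a * val y' + val x * b); rewrite raddfD /= !coboundaryM dx dy'.
by rewrite mulr0 mul0r addr0 add0r -xa -yb mulrBl mulrBr addrA subrK.
Qed.

Lemma pi_cohomD x y :
  \pi_(cohomology n) x + \pi_(cohomology n) y = \pi_(cohomology n) (x + y).
Proof. by rewrite [RHS]Quotient.pi_add. Qed.

Lemma cohom_mulA : associative (@cohom_mul n).
Proof.
elim/quotW=> x; elim/quotW=> y; elim/quotW=> z.
by rewrite (pi_cohom_mul y z) (pi_cohom_mul x y) 2!pi_cohom_mul mulrA.
Qed.

Lemma cohom_mul1l : left_id (cohom_one n) (@cohom_mul n).
Proof. by elim/quotW=> x; rewrite pi_cohom_mul mul1r. Qed.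

Lemma cohom_mul1r : right_id (cohom_one n) (@cohom_mul n).
Proof. by elim/quotW=> x; rewrite pi_cohom_mul mulr1. Qed.

Lemma cohom_mulDl : left_distributive (@cohom_mul n) +%R.
Proof.
elim/quotW=> x; elim/quotW=> y; elim/quotW=> z.
by rewrite (pi_cohomD x y) 3!pi_cohom_mul pi_cohomD mulrDl.
Qed.

Lemma cohom_mulDr : right_distributive (@cohom_mul n) +%R.
Proof.
elim/quotW=> x; elim/quotW=> y; elim/quotW=> z.
by rewrite (pi_cohomD y z) 3!pi_cohom_mul pi_cohomD mulrDr.
Qed.

End CohomologyRing.

HB.instance Definition _ n := GRing.Zmodule_isPzRing.Build (cohomology n)
  (@cohom_mulA n) (@cohom_mul1l n) (@cohom_mul1r n)
  (@cohom_mulDl n) (@cohom_mulDr n).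

(* Meant for cocycles: insubd sends every other cochain to 0. *)
Definition coclass n (c : cochain n) : cohomology n :=
  \pi_(cohomology n) (insubd 0 c).

(* Transfer of v from the entry at position j to the entry at position k. *)
Definition move n (v : 'I_n) (j k : nat) (t : 8.-tuple {set 'I_n}) :
    8.-tuple {set 'I_n} :=
  [tuple if i == j :> nat then tnth t i :\ v
         else if i == k :> nat then v |: tnth t i
         else tnth t i | i < 8].

Definition is_min n (A : {set 'I_n}) (a : 'I_n) : bool :=
  (a \in A) && [forall b in A, (a <= b)%N].
Definition is_max n (A : {set 'I_n}) (a : 'I_n) : bool :=
  (a \in A) && [forall b in A, (b <= a)%N].

Definition W_min n (i : nat) (s t : cell n) : bool :=
  [exists a, [&& is_min (xset i s :|: yset i s) a, a \in xset i s
               & entries t == move a (X i) (Y i) s]].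

Definition W_min3 n (s t : cell n) : bool :=
  [exists a, [&& is_min (xset 3 s :|: yset 3 s) a, a \in xset 3 s,
                 (2 <= #|xset 3 s|)%N & entries t == move a (X 3) (Y 3) s]].

Definition W_max4 n (s t : cell n) : bool :=
  [exists a, exists b,
    [&& is_min (xset 3 s :|: yset 3 s) a, xset 3 s == [set a],
        is_max (yset 3 s :|: xset 4 s) b, b \in xset 4 s,
        (2 <= #|xset 4 s|)%N, (a < b)%N
      & entries t == move b (X 4) (Y 3) s]].

(* s is the lower cell of the pair and t = W(s). *)
Definition W_pair n (s t : cell n) : bool :=
  if xset 1 s :|: yset 1 s != set0 then W_min 1 s t
  else if xset 2 s :|: yset 2 s != set0 then W_min 2 s t
  else W_min3 s t || W_max4 s t.

Definition critical n (s : cell n) : bool :=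
  ~~ [exists t, W_pair s t || W_pair t s].

Definition upper_step n (s t : cell n) : bool :=
  (s != t) && [exists m, W_pair s m && face t m].

(* W is acyclic, so the cells of an upper W-path are pairwise distinct: it is
   enough to count the paths t :: p with size p < #|cell n|. *)
Definition num_upper_paths n (t s : cell n) : nat :=
  (\sum_(q < #|{: cell n}|)
     #|[set p : q.-tuple (cell n) | path (@upper_step n) t p
                                    && (last t p == s)]|)%N.

Definition dual_cocycle n (s : cell n) : cochain n :=
  [ffun t : cell n => if cell_dim t == cell_dim s then (num_upper_paths t s)%:R else 0].

Definition dual_class n (s : cell n) : cohomology n :=
  coclass (dual_cocycle s).

(* Main.v *)
Require Import Defs.
From mathcomp Require Import all_boot all_algebra.
From mathcomp Require Import zify.
Set Implicit Arguments.
Unset Strict Implicit.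
Unset Printing Implicit Defensive.
Import GRing.Theory.

(* The identity already holds for cochains. Let e_D be the indicator cochain of
   the cells with y_4 = D and no label on another edge; it is the product of
   the e_{w}, w in D, for Serre's cup product. The cocycle dual to sigma_i is
   exactly e_{w_i}: a label on edge 4 is never created by an upper W-path, and
   on the cells counted by e_{w} each step carries the one moving label across
   its edge, so that there is a unique upper path to sigma_i. On the right-hand
   side the cells have the top dimension n - 2, so their dual cocycles are their
   indicators, and the cells counted by e_D are precisely these two. *)

(** * Counting paths of a relation on a finite type *)

Section PathCount.
Variables (T : finType) (e : rel T).

(** One summand of [num_upper_paths], for an arbitrary finite relation. *)
Definition npaths q (x z : T) : nat :=
  #|[set p : q.-tuple T | path e x p && (last x p == z)]|.

Lemma npaths0 x z : npaths 0 x z = (x == z).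
Proof.
rewrite /npaths; case: eqP => [->|xz].
  rewrite (_ : [set _ | _] = [set [tuple]]) ?cards1 //.
  by apply/setP=> p; rewrite !inE tuple0 /= !eqxx.
by apply/eqP; rewrite cards_eq0; apply/eqP/setP=> p; rewrite !inE tuple0 /=; apply/eqP.
Qed.

Lemma npathsS q x z : npaths q.+1 x z = (\sum_(y | e x y) npaths q y z)%N.
Proof.
rewrite /npaths -sum1_card (partition_big (fun p : q.+1.-tuple T => thead p) (e x)) /=.
  apply: eq_bigr => y exy.
  rewrite (reindex_onto (fun p : q.-tuple T => [tuple of y :: p])
                        (fun p : q.+1.-tuple T => [tuple of behead p])) /=.
    rewrite -sum1_card; apply: eq_bigl => p.
    rewrite !inE /= theadE eqxx exy /= andbT.
    by rewrite (_ : _ == p) ?andbT //; apply/eqP/val_inj.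
  move=> p /andP[_ /eqP <-]; apply: val_inj.
  by case/tupleP: p => a p /=; rewrite theadE.
move=> p; rewrite inE; case/tupleP: p => a p /=.
by rewrite theadE => /andP[/andP[]].
Qed.

Lemma sum_npaths_end x z : (forall y, ~~ e x y) ->
  (\sum_(q < #|T|) npaths q x z)%N = (x == z).
Proof.
move=> xN; have : (0 < #|T|)%N by apply/card_gt0P; exists x.
case: #|T| => // m _; rewrite big_ord_recl npaths0 big1 ?addn0 // => i _.
by rewrite npathsS big_pred0 // => y; apply: negbTE.
Qed.

(** Since [P] is inherited backwards along steps and holds at [z], a path to [z] never leaves [P].
    Inside [P] every element other than [z] has exactly one successor, of smaller rank, so the path
    is forced and must stop at [z]. *)
Lemma sum_npaths (P : pred T) (r : T -> nat) (z : T) :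
  (forall x y, e x y -> P y -> P x) ->
  P z -> (forall y, ~~ e z y) ->
  (forall x, P x -> x != z -> exists y,
     [/\ P y, e x y, (r y < r x)%N & forall y', P y' -> e x y' -> y' = y]) ->
  forall x, (\sum_(q < #|T|) npaths q x z)%N = P x.
Proof.
move=> Pb Pz zN nxt.
have np0 q x : ~~ P x -> npaths q x z = 0%N.
  elim: q x => [|q IH] x Px.
    by rewrite npaths0; case: eqP Px => // ->; rewrite Pz.
  by rewrite npathsS big1 // => y exy; apply: IH; apply: contra Px; apply: Pb.
(* The rank is replaced by the number of elements of smaller rank. It still drops along the forced
   step and stays below [#|T|], so the forced path is short enough to be counted in the sum. *)
pose h x := #|[set y | (r y < r x)%N]|.
have main m x : P x -> (h x < m)%N -> (\sum_(q < m) npaths q x z)%N = 1%N.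
  elim: m x => [//|m IH] x Px; rewrite ltnS => hm.
  rewrite big_ord_recl npaths0.
  under eq_bigr do rewrite lift0 npathsS.
  rewrite exchange_big /=; have [xz|xz] := eqVneq x z.
    by rewrite big_pred0 ?addn0 // => y; rewrite xz (negbTE (zN y)).
  have [y [Py exy rxy uniq_y]] := nxt x Px xz.
  rewrite (bigD1 y) //= IH //; last first.
    apply: leq_trans hm; apply: proper_card; apply/properP; split.
      by apply/subsetP=> u; rewrite !inE => /ltn_trans; apply.
    by exists y; rewrite !inE ?ltnn.
  rewrite big1 // => y' /andP[exy' y'y]; rewrite big1 // => i _.
  apply: np0; apply: contra y'y => Py'; apply/eqP; exact: uniq_y.
move=> x; case Px: (P x); last by rewrite big1 // => i _; apply: np0; rewrite Px.
apply: main => //; rewrite -cardsT; apply: proper_card.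
by apply/properP; split; [apply: subsetT | exists x; rewrite !inE ?ltnn].
Qed.

End PathCount.

(** * Cells as functions from labels to positions *)

Section Loc.
Variable n : nat.
Implicit Types (s t m : cell n) (U : {set 'I_n}) (v u : 'I_n).

(** A cell is a partition of the labels, so it is the same as a function to the positions 0 to 7:
    even for vertices, odd for edges. Vertices 3 and 4 have positions 4 and 6, edge 4 has position
    7. *)
Definition loc s v : nat := find (fun A : {set 'I_n} => v \in A) s.

Lemma in_entry s v k : (v \in nth set0 s k) = (loc s v == k).
Proof.
have /is_cellP [[f Hf] _ _] := entriesP s.
have inf j : v \in nth set0 s j -> j = f v.
  have [j8|j8] := ltnP j 8.
    by rewrite -[j]/(nat_of_ord (Ordinal j8)) entry_tnth Hf => /eqP ->.
  by rewrite nth_default ?size_tuple // inE.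
have hs : has (fun A : {set 'I_n} => v \in A) s.
  by apply/hasP; exists (tnth s (f v)); rewrite ?mem_tnth // Hf.
have /inf El := nth_find set0 hs; rewrite -/(loc s v) in El.
apply/idP/eqP => [/inf ->//|<-]; exact: (nth_find set0 hs).
Qed.

Lemma in_tnth s v (j : 'I_8) : (v \in tnth s j) = (loc s v == j).
Proof. by rewrite -entry_tnth in_entry. Qed.

Lemma loc_lt8 s v : (loc s v < 8)%N.
Proof.
have: v \in nth set0 s (loc s v) by rewrite in_entry.
by apply: contraTT; rewrite -leqNgt => ?; rewrite nth_default ?size_tuple // inE.
Qed.

Lemma locP s t : loc s =1 loc t -> s = t.
Proof.
by move=> st; apply: cell_eqP => j; apply/setP=> v; rewrite !in_tnth st.
Qed.

Lemma in_edges s v : (v \in edges s) = odd (loc s v).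
Proof. by apply: (@mem_edges _ _ (Ordinal (loc_lt8 s v))); rewrite in_tnth. Qed.

Lemma in_xset i s v : (v \in xset i s) = (loc s v == X i).
Proof. exact: in_entry. Qed.

Lemma loc_xset i s v : v \in xset i s -> loc s v = X i.
Proof. by rewrite in_xset => /eqP. Qed.

Lemma in_yset i s v : (v \in yset i s) = (loc s v == Y i).
Proof. exact: in_entry. Qed.

Lemma loc_back U s v :
  loc (back U s) v = if (v \in U) && odd (loc s v) then (loc s v).-1 else loc s v.
Proof.
have l8 := loc_lt8 s v; set p := (if _ then _ else _).
have p8 : (p < 8)%N by rewrite /p; case: ifP => // _; lia.
apply/eqP; rewrite -in_entry (entry_tnth (back U s) (Ordinal p8)) tnth_mktuple /=.
case: ifP => op; rewrite !inE !in_tnth /= /p in op *; case: (v \in U) op => /=.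
- by case: ifP => ol; lia.
- by rewrite eqxx.
- case: ifP => ol; rewrite ?eqxx //; lia.
- by rewrite eqxx.
Qed.

Lemma loc_fwd U s v :
  loc (fwd U s) v =
  if (v \in U) && odd (loc s v) then ((loc s v).+1 %% 8)%N else loc s v.
Proof.
have l8 := loc_lt8 s v; set p := (if _ then _ else _).
have p8 : (p < 8)%N by rewrite /p; case: ifP => // _; lia.
apply/eqP; rewrite -in_entry (entry_tnth (fwd U s) (Ordinal p8)) tnth_mktuple /=.
case: ifP => op; rewrite !inE !in_tnth /= /p in op *; case: (v \in U) op => /=.
- by case: ifP => ol; lia.
- by rewrite eqxx.
- case: ifP => ol; rewrite ?eqxx //; lia.
- by rewrite eqxx.
Qed.

Lemma cell_dimE s : cell_dim s = #|edges s|.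
Proof.
transitivity (\sum_v \sum_(1 <= i < 5) (loc s v == Y i : nat))%N.
  rewrite exchange_big /=; apply: eq_bigr => i _.
  by rewrite -sum1_card big_mkcond; apply: eq_bigr => v _; rewrite in_yset; case: eqP.
rewrite -sum1_card [RHS]big_mkcond; apply: eq_bigr => v _; rewrite in_edges.
rewrite unlock /Y /=; move: (loc s v) (loc_lt8 s v).
by do 8! (case=> [//|]).
Qed.

Lemma occupied3 s : exists v, loc s v = 4.
Proof.
have /is_cellP[_ /set0Pn[v]] := entriesP s.
by rewrite in_xset => /eqP vx; exists v.
Qed.

Lemma occupied4 s : exists v, loc s v = 6.
Proof.
have /is_cellP[_ _ /set0Pn[v]] := entriesP s.
by rewrite in_xset => /eqP vx; exists v.
Qed.

(** Vertices 3 and 4 each hold a label, and these two labels lie on no edge. *)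
Lemma card_edges s : (#|edges s| <= n - 2)%N.
Proof.
have [u u3] := occupied3 s; have [v v4] := occupied4 s.
have uv : u != v by apply: contra_eq_neq u3 => ->; rewrite v4.
have E := cardsC [set u; v]; rewrite cards2 uv card_ord /= in E.
move: (congr1 (subn^~ 2) E); rewrite /= addKn => <-.
apply/subset_leq_card/subsetP=> x.
by rewrite in_edges !inE; apply: contraTN => /orP[] /eqP ->; rewrite ?u3 ?v4.
Qed.

Lemma loc_move s m a j k : entries m = move a j k s -> loc s a = j -> j <> k ->
  (k < 8)%N -> forall v, loc m v = if v == a then k else loc s v.
Proof.
move=> Em aj jk k8 v; have l8 := loc_lt8 s v; set p := (if _ then _ else _).
have p8 : (p < 8)%N by rewrite /p; case: ifP.
apply/eqP; rewrite -in_entry (entry_tnth m (Ordinal p8)) Em tnth_mktuple /=.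
rewrite !(fun_if (fun A : {set 'I_n} => v \in A)) !inE !in_tnth /= {p8}/p.
have [->|va] := eqVneq v a.
  by rewrite eqxx; case: eqP => [kj|]; first by case: jk.
by rewrite eqxx !orbT; do 2 case: (_ == _ :> nat).
Qed.

(** The two existence hypotheses keep vertices 3 and 4 occupied after [a] has left, which makes the
    moved tuple a cell. *)
Lemma exists_move s a j k : loc s a = j -> j <> k -> (k < 8)%N ->
  (exists2 u, u != a & loc s u = 4) -> (exists2 u, u != a & loc s u = 6) ->
  exists m, entries m = move a j k s.
Proof.
move=> aj jk k8 [u3 u3a l3] [u4 u4a l4].
have E v (i : 'I_8) :
    (v \in tnth (move a j k s) i) = ((if v == a then k else loc s v) == i).
  rewrite tnth_mktuple !(fun_if (fun A : {set 'I_n} => v \in A)) !inE in_tnth.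
  have [->|va] /= := eqVneq v a; last by do 2 case: (_ == _ :> nat).
  rewrite aj; have [ij|ij] := eqVneq (i : nat) j.
    by rewrite ij; symmetry; apply/eqP => kj; case: jk.
  by rewrite [RHS]eq_sym; case: (_ == _).
have mP : is_cell (move a j k s).
  apply/is_cellP; split.
  - exists (fun v => inord (if v == a then k else loc s v)) => i v.
    by rewrite E -[RHS]val_eqE /= inordK //; case: ifP => // _; apply: loc_lt8.
  - apply/set0Pn; exists u3.
    by rewrite /xset (entry_tnth _ (@Ordinal 8 4 isT)) E (negbTE u3a) l3.
  - apply/set0Pn; exists u4.
    by rewrite /xset (entry_tnth _ (@Ordinal 8 6 isT)) E (negbTE u4a) l4.
by exists (Cell mP).
Qed.

End Loc.

(** * Pairs of the matching and steps of upper paths *)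

Section Steps.
Variable n : nat.
Implicit Types (s t m : cell n) (A D : {set 'I_n}) (a b u v w : 'I_n).

Lemma is_minP A a : reflect (a \in A /\ forall u, u \in A -> a <= u) (is_min A a).
Proof.
apply: (iffP andP) => -[aA aP]; split=> //.
  by move=> u uA; move/forall_inP: aP => /(_ u uA).
by apply/forall_inP.
Qed.

Lemma is_maxP A a : reflect (a \in A /\ forall u, u \in A -> u <= a) (is_max A a).
Proof.
apply: (iffP andP) => -[aA aP]; split=> //.
  by move=> u uA; move/forall_inP: aP => /(_ u uA).
by apply/forall_inP.
Qed.

Lemma ex_min A : A != set0 -> exists a, is_min A a.
Proof.
case/set0Pn=> u uA; case: (@arg_minnP _ u (mem A) val uA) => a aA aP.
by exists a; apply/is_minP.
Qed.

Lemma ex_max A : A != set0 -> exists a, is_max A a.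
Proof.
case/set0Pn=> u uA; case: (@arg_maxnP _ u (mem A) val uA) => a aA aP.
by exists a; apply/is_maxP.
Qed.

Lemma is_min_uniq A a b : is_min A a -> is_min A b -> b = a.
Proof.
move=> /is_minP[aA aP] /is_minP[bA bP]; apply/val_inj/eqP.
by rewrite eqn_leq aP // bP.
Qed.

Lemma is_max_uniq A a b : is_max A a -> is_max A b -> b = a.
Proof.
move=> /is_maxP[aA aP] /is_maxP[bA bP]; apply/val_inj/eqP.
by rewrite eqn_leq aP // bP.
Qed.

(** This is what all rules of the matching share: one label passes from a vertex onto an edge. The
    bound [k < 7] records that this edge is never edge 4. *)
Lemma W_pair_move t m : W_pair t m -> exists a j k,
  [/\ entries m = move a j k t, loc t a = j, ~~ odd j, odd k & k < 7].
Proof.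
rewrite /W_pair; case: ifP => _.
  case/existsP=> a /and3P[_]; rewrite in_xset => /eqP ax /eqP Em.
  by exists a, (X 1), (Y 1).
case: ifP => _.
  case/existsP=> a /and3P[_]; rewrite in_xset => /eqP ax /eqP Em.
  by exists a, (X 2), (Y 2).
case/orP; first case/existsP=> a /and4P[_].
  by rewrite in_xset => /eqP ax _ /eqP Em; exists a, (X 3), (Y 3).
case/existsP=> a /existsP[b] /and5P[_ _ _]; rewrite in_xset => /eqP bx.
by case/and3P=> _ _ /eqP Em; exists b, (X 4), (Y 3).
Qed.

Lemma W_pair_edges t m : W_pair t m -> #|edges m| = #|edges t|.+1.
Proof.
case/W_pair_move=> a [j [k [Em aj oj ok k7]]].
have jk : j <> k by move=> jk; rewrite jk ok in oj.
have lm := loc_move Em aj jk (ltnW k7).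
have -> : edges m = a |: edges t.
  apply/setP=> u; rewrite !inE !in_edges lm.
  by have [->|//] := eqVneq u a; rewrite ok.
by rewrite cardsU1 in_edges aj oj.
Qed.

Lemma upper_step_edges t t' : upper_step t t' -> #|edges t| = #|edges t'|.
Proof.
case/andP=> _ /existsP[m /andP[/W_pair_edges Em /existsP[v /andP[vm tE]]]].
have -> : edges t' = edges m :\ v.
  by case/orP: tE => /eqP ->; rewrite ?edges_back ?edges_fwd.
by move: Em; rewrite (cardsD1 v) vm => -[].
Qed.

(** The matching puts no label on edge 4, and passing to a face only takes labels off edges. *)
Lemma upper_step_yset4 t t' w :
  upper_step t t' -> w \in yset 4 t' -> w \in yset 4 t.
Proof.
case/andP=> _ /existsP[m /andP[/W_pair_move[a [j [k [Em aj oj ok k7]]]] tm]].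
have jk : j <> k by move=> jk; rewrite jk ok in oj.
rewrite !in_yset => w7.
have : loc m w == 7.
  case/existsP: tm => u /andP[_ /orP[] /eqP tE];
    move: w7; rewrite tE ?loc_back ?loc_fwd;
    case: ifP => // /andP[_]; have := loc_lt8 m w; rewrite /Y /=; lia.
rewrite (loc_move Em aj jk (ltnW k7)); case: ifP => // _ /eqP k7'.
by rewrite k7' in k7.
Qed.

Lemma W_minE t m i a : is_min (xset i t :|: yset i t) a -> a \in xset i t ->
  W_min i t m = (entries m == move a (X i) (Y i) t).
Proof.
move=> amin ax; apply/existsP/idP => [[b /and3P[bmin _]]|Em].
  by rewrite (is_min_uniq amin bmin).
by exists a; rewrite amin ax.
Qed.

Lemma W_min3E t m a : is_min (xset 3 t :|: yset 3 t) a -> a \in xset 3 t ->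
  W_min3 t m = (1 < #|xset 3 t|) && (entries m == move a (X 3) (Y 3) t).
Proof.
move=> amin ax; apply/existsP/idP => [[b /and4P[bmin _]]|/andP[ct Em]].
  by rewrite (is_min_uniq amin bmin) => -> ->.
by exists a; rewrite amin ax ct.
Qed.

Lemma W_max4E t m a b : is_min (xset 3 t :|: yset 3 t) a ->
  is_max (yset 3 t :|: xset 4 t) b -> b \in xset 4 t ->
  W_max4 t m = [&& xset 3 t == [set a], 1 < #|xset 4 t|, a < b &
                   entries m == move b (X 4) (Y 3) t].
Proof.
move=> amin bmax bx; apply/existsP/idP => [[a' /existsP[b']]|].
  case/and5P=> amin' x3 bmax' _ /and3P[c4 lt_ab Em].
  move: x3 lt_ab Em; rewrite (is_min_uniq amin amin') (is_max_uniq bmax bmax').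
  by move=> -> -> ->; rewrite c4.
case/and4P=> x3 c4 lt_ab Em; exists a; apply/existsP; exists b.
by rewrite amin x3 bmax bx c4 lt_ab.
Qed.

(** Equivalent to y_4 = D with all other edges empty. Both [edges] and [yset 4] lose exactly [U]
    under [back U] and [fwd U], so this form is easy to evaluate on faces. *)
Definition edges_on4 D t := (edges t == D) && (D \subset yset 4 t).

Lemma edges_on4_set1 w t :
  reflect (loc t w = 7 /\ forall u, u != w -> ~~ odd (loc t u))
          (edges_on4 [set w] t).
Proof.
rewrite /edges_on4 sub1set in_yset.
apply: (iffP andP) => -[] => [/eqP Et /eqP w7|w7 tE]; split=> //.
- by move=> u; rewrite -in_edges Et inE.
- apply/eqP/setP=> u; rewrite in_edges inE.
  by have [->|uw] := eqVneq u w; [rewrite w7 | apply: negbTE; apply: tE].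
- exact/eqP.
Qed.

End Steps.

(** * Unique upper paths to a critical cell of dimension one *)

Section OneEdge.
Variable n : nat.
Hypothesis hn : 4 <= n.
Implicit Types (s t m : cell n) (a b u v w : 'I_n).

Lemma card_x4_one_edge t a w : a != w ->
  (forall u, loc t u = if u == a then 4 else if u == w then 7 else 6) ->
  1 < #|xset 4 t|.
Proof.
move=> aw lt; have -> : xset 4 t = ~: [set a; w].
  apply/setP=> u; rewrite in_xset lt !inE.
  by case: (u == a); case: (u == w).
(* Vertex 4 holds all labels but [a] and [w], hence [n - 2] of them; this is at least 2 because
   [4 <= n]. *)
have E := cardsC [set a; w]; rewrite cards2 aw card_ord /= in E.
by move: (congr1 (subn^~ 2) E); rewrite /= addKn => ->; lia.
Qed.

Variables (s : cell n) (v w : 'I_n) (Z : {set 'I_n}).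
Hypothesis crit_s : critical s.
Hypothesis s_entries : entries s =
  [tuple set0; set0; set0; set0; [set v]; set0; Z; [set w]].

Lemma loc_one_edge u : loc s u = if u == v then 4 else if u == w then 7 else 6.
Proof.
have H k : (u \in nth set0 [tuple set0; set0; set0; set0; [set v]; set0; Z; [set w]] k)
   = (loc s u == k) by rewrite -in_entry s_entries.
have [uv|uv] := eqVneq u v.
  by apply/eqP; rewrite -H /= uv inE.
have [uw|uw] := eqVneq u w.
  by apply/eqP; rewrite -H /= uw inE.
have := loc_lt8 s u; have := H (loc s u); rewrite eqxx.
case: (loc s u) => [|[|[|[|[|[|[|[|//]]]]]]]] //=; rewrite ?inE //.
  by rewrite (negbTE uv).
by rewrite (negbTE uw).
Qed.

Lemma v_neq_w : v != w.
Proof.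
have : w \in nth set0 s 7 by rewrite s_entries /= inE.
by rewrite in_entry loc_one_edge; case: (eqVneq v w).
Qed.

Lemma one_edge_xy12 i : i \in [:: 1; 2] -> xset i s :|: yset i s = set0.
Proof.
rewrite !inE => i12; apply/setP=> u; rewrite !inE in_xset in_yset loc_one_edge.
by case/orP: i12 => /eqP ->; case: (u == v); case: (u == w).
Qed.

(** If a label at vertex 4 exceeded [v], the largest label [b] there could move onto edge 3, and [s]
    would be the lower cell of a pair. So [v] is the largest label other than [w]. *)
Lemma critical_max u : u != w -> u <= v.
Proof.
move=> uw; rewrite leqNgt; apply/negP=> vu.
have uv : u != v by apply: contraTneq vu => ->; rewrite ltnn.
have xE : xset 3 s = [set v].
  by apply/setP=> x; rewrite in_xset loc_one_edge inE; case: (x == v); case: (x == w).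
have yE : yset 3 s = set0.
  by apply/setP=> x; rewrite in_yset loc_one_edge inE; case: (x == v); case: (x == w).
have ux : u \in xset 4 s by rewrite in_xset loc_one_edge (negbTE uv) (negbTE uw).
have [|b bmax] := @ex_max _ (xset 4 s); first by apply/set0Pn; exists u.
have /is_maxP[bx bP] := bmax.
have c4 := card_x4_one_edge v_neq_w loc_one_edge.
have b6 : loc s b = 6 := loc_xset bx.
have [m Em] : exists m, entries m = move b 6 5 s.
  apply: exists_move => //.
    by have [x x4] := occupied3 s; exists x => //;
      apply: contra_eq_neq x4 => ->; rewrite b6.
  have : 0 < #|xset 4 s :\ b| by move: c4; rewrite (cardsD1 b) bx.
  by case/card_gt0P=> x /setD1P[xb]; rewrite in_xset => /eqP; exists x.
case/existsP: crit_s; exists m; apply/orP; left.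
rewrite /W_pair !one_edge_xy12 // eqxx /=; apply/orP; right.
rewrite (@W_max4E _ s m v b) ?yE ?set0U //; last first.
  by rewrite xE setU0; apply/is_minP; split=> [|x]; rewrite inE // => /eqP ->.
by rewrite xE eqxx c4 (leq_trans vu (bP u ux)) Em eqxx.
Qed.

(* Along an upper path to [s], [v] ends at vertex 3 and all other labels off
   [w] end at vertex 4; this is an additive distance to that position. *)
Definition weight u p :=
  match p with
  | 0 => 3 | 2 => 2 | 4 => u != v : nat | 6 => u == v : nat | _ => 0
  end.
Definition rank t := \sum_u weight u (loc t u).

Lemma rank_ltn t t' a p : (forall u, loc t' u = if u == a then p else loc t u) ->
  weight a p < weight a (loc t a) -> rank t' < rank t.
Proof.
move=> lt' wap; rewrite /rank (bigD1 a) //= [X in _ < X](bigD1 a) //= lt' eqxx.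
rewrite -addSn leq_add // leq_eqVlt; apply/orP; left; apply/eqP.
by apply: eq_bigr => u ua; rewrite lt' (negbTE ua).
Qed.

(** The matching moves [a] onto edge [k], and [p] is the other end of that edge. Minimal labels at
    vertices 1, 2, 3 travel forward; the only backward move brings [v] from vertex 4 to vertex 3. *)
Lemma next_move t : edges_on4 [set w] t -> t != s -> exists a k p,
  [/\ a != w,
      odd k && (k < 7),
      (loc t a = k.-1 /\ p = k.+1) \/ (loc t a = k.+1 /\ p = k.-1),
      (forall m, W_pair t m = (entries m == move a (loc t a) k t))
      /\ exists m, entries m = move a (loc t a) k t &
      weight a p < weight a (loc t a)].
Proof.
move=> /edges_on4_set1[w7 tE] ts.
have not_odd u k : odd k -> k != 7 -> loc t u != k.
  move=> ok; apply: contraNneq => lu; have [uw|/tE] := eqVneq u w.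
    by rewrite -lu uw w7.
  by rewrite lu ok.
have y0 i : i < 4 -> yset i t = set0.
  move=> i4; apply/setP=> u; rewrite in_yset inE; apply: negbTE; apply: not_odd.
    by rewrite /Y /= odd_double.
  by rewrite /Y; case: i i4 => [|[|[|[|]]]].
have ex2 a p : loc t a != p -> forall u, loc t u = p -> exists2 x, x != a & loc t x = p.
  by move=> ap u up; exists u => //; apply: contraNneq ap => <-; rewrite up.
have aw a : loc t a != 7 -> a != w by apply: contraNneq => ->; rewrite w7.
have [[u3 l3] [u4 l4]] := (occupied3 t, occupied4 t).
(* Vertices 1 and 2 are treated together: [y_i] is empty, so the minimum lies in [x_i] and [t] is a
   lower cell. *)
have lowcase i : i \in [:: 1; 2] -> xset i t :|: yset i t != set0 ->
    exists a, [/\ loc t a = X i,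
                  (forall m, W_min i t m = (entries m == move a (X i) (Y i) t))
                & exists m, entries m = move a (X i) (Y i) t].
  move=> i12 xy0.
  have [i4 XY Y8 X4 X6] : [/\ i < 4, X i <> Y i, Y i < 8, X i != 4 & X i != 6].
    by move: i12; rewrite !inE => /orP[] /eqP ->.
  have [a amin] := ex_min xy0; have /is_minP[+ _] := amin.
  rewrite (y0 i i4) setU0 => ax; have lx := loc_xset ax.
  exists a; split=> // [m|]; first exact: W_minE.
  apply: exists_move => //; [apply: ex2 l3 | apply: ex2 l4]; by rewrite lx.
have [xy1|xy1] := boolP (xset 1 t :|: yset 1 t != set0).
  have [//|a [la Wa ex_m]] := lowcase 1 _ xy1.
  exists a, 1, 2; rewrite la; split=> //; first by apply: aw; rewrite la.
    by left.
  by split=> // m; rewrite /W_pair xy1.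
have [xy2|xy2] := boolP (xset 2 t :|: yset 2 t != set0).
  have [//|a [la Wa ex_m]] := lowcase 2 _ xy2.
  exists a, 3, 4; rewrite la; split=> //; first by apply: aw; rewrite la.
  - by left.
  - by split=> // m; rewrite /W_pair (negbTE xy1) xy2.
  by rewrite /=; case: (_ == _).
have WE m : W_pair t m = W_min3 t m || W_max4 t m.
  by rewrite /W_pair (negbTE xy1) (negbTE xy2).
have l46 u : u != w -> (loc t u == 4) || (loc t u == 6).
  move=> uw; move: (tE u uw) (loc_lt8 t u).
  move: xy1 xy2; rewrite !negbK => /eqP/setP/(_ u) + /eqP/setP/(_ u).
  rewrite !inE !in_xset !in_yset /X /Y /=.
  by case: (loc t u) => [|[|[|[|[|[|[|[|]]]]]]]].
have [|a amin] := @ex_min _ (xset 3 t :|: yset 3 t).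
  by apply/set0Pn; exists u3; rewrite inE in_xset l3.
have /is_minP[ax aP] := amin; move: ax aP; rewrite (y0 3) // setU0 => ax aP.
have la : loc t a = 4 := loc_xset ax.
(* With two labels at vertex 3, the smaller of them moves on to vertex 4. It is not [v], which is
   the largest label off [w], so its weight drops. *)
have [c3|c3] := ltnP 1 #|xset 3 t|.
  have : 0 < #|xset 3 t :\ a| by move: c3; rewrite (cardsD1 a) ax.
  case/card_gt0P=> x /setD1P[xa xx].
  have lx : loc t x = 4 := loc_xset xx.
  exists a, 5, 6; rewrite la; split=> //; first by apply: aw; rewrite la.
  - by left.
  - split=> [m|]; last first.
      by apply: exists_move => //; [exists x | apply: ex2 l4; rewrite la].
    rewrite WE (W_min3E _ amin ax) c3 /=.
    case: (boolP (W_max4 t m)); rewrite ?orbF // => W4.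
    case/existsP: W4 => ? /existsP[? /and3P[_ /eqP x3 _]].
    by rewrite x3 cards1 in c3.
  have av : a != v.
    apply: contraNneq xa => av; apply/eqP/val_inj/eqP; rewrite eqn_leq aP // av.
    by rewrite andbT critical_max // aw // lx.
  by rewrite /= av (negbTE av).
(* Now [a] is alone at vertex 3 and differs from [v], since otherwise [t] would be [s]. So [v] is
   the maximum at vertex 4 and moves back across edge 3. *)
have x3 : xset 3 t = [set a].
  by apply/eqP; rewrite eq_sym eqEcard sub1set ax cards1.
have ltE u : loc t u = if u == a then 4 else if u == w then 7 else 6.
  have [->|ua] := eqVneq u a; first exact: la.
  have [->|uw] := eqVneq u w; first exact: w7.
  case/orP: (l46 u uw) => /eqP // l; case/negP: ua.
  by rewrite -in_set1 -x3 in_xset l.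
have a_neq_w : a != w by apply: aw; rewrite la.
have av : a != v.
  by apply: contraNneq ts => av; apply/eqP/locP => u; rewrite ltE loc_one_edge av.
have lv : loc t v = 6 by rewrite ltE eq_sym (negbTE av) (negbTE v_neq_w).
have c4 := card_x4_one_edge a_neq_w ltE.
exists v, 5, 4; rewrite lv; split=> //.
- exact: v_neq_w.
- by right.
- split=> [m|].
    have bx : v \in xset 4 t by rewrite in_xset lv.
    rewrite WE (W_min3E _ amin ax) ltnNge c3 /= (@W_max4E _ t m a v) //; last first.
      rewrite y0 // set0U; apply/is_maxP; split=> // u; rewrite in_xset => /eqP u6.
      by apply: critical_max; apply: aw; rewrite u6.
    have -> : a < v by rewrite ltn_neqAle critical_max // andbT; exact: av.
    by rewrite x3 eqxx c4.
  apply: exists_move => //; first by apply: ex2 l3; rewrite lv.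
  have : 0 < #|xset 4 t :\ v| by move: c4; rewrite (cardsD1 v) in_xset lv.
  by case/card_gt0P=> x /setD1P[xb]; rewrite in_xset => /eqP; exists x.
by rewrite /= eqxx.
Qed.

(** The cell W(t) has only [a] and [w] on edges. Its faces along [w] take [w] off edge 4; of the two
    along [a], one is [t] itself and the other is the successor. *)
Lemma next_step t : edges_on4 [set w] t -> t != s -> exists t',
  [/\ edges_on4 [set w] t', upper_step t t', rank t' < rank t
    & forall t'', edges_on4 [set w] t'' -> upper_step t t'' -> t'' = t'].
Proof.
move=> tw ts; have [a [k [p [aw /andP[ok k7] akp [Wt [m Em]] wap]]]] := next_move tw ts.
have /edges_on4_set1[w7 tE] := tw.
have ka : loc t a <> k by move=> E; move: (tE a aw); rewrite E ok.
have lm u := loc_move Em erefl ka (ltnW k7) u.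
have lmw : loc m w = 7 by rewrite lm eq_sym (negbTE aw).
have lma : loc m a = k by rewrite lm eqxx.
have om u : odd (loc m u) = (u == a) || (u == w).
  rewrite lm; have [->|ua] := eqVneq u a; first by rewrite ok.
  by have [->|uw] := eqVneq u w; [rewrite w7 | apply: negbTE; apply: tE].
have lB u : loc (back [set a] m) u = if u == a then k.-1 else loc t u.
  rewrite loc_back inE; have [->|ua] /= := eqVneq u a; first by rewrite lma ok.
  by rewrite lm (negbTE ua).
(* Because [k < 7], the terminal position [k.+1] needs no reduction mod 8. *)
have lF u : loc (fwd [set a] m) u = if u == a then k.+1 else loc t u.
  rewrite loc_fwd inE; have [->|ua] /= := eqVneq u a.
    by rewrite lma ok modn_small.
  by rewrite lm (negbTE ua).
have am : a \in edges m by rewrite in_edges om eqxx.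
have [t' lt' tt'] : exists2 t', forall u, loc t' u = if u == a then p else loc t u &
    forall t'', (t'' == back [set a] m) || (t'' == fwd [set a] m)
      = (t'' == t) || (t'' == t').
  case: akp => -[la ->].
    exists (fwd [set a] m) => // t''; suff -> : t = back [set a] m by [].
    by apply: locP => u; rewrite lB; case: eqP => // ->.
  exists (back [set a] m) => // t''; suff -> : t = fwd [set a] m by rewrite orbC.
  by apply: locP => u; rewrite lF; case: eqP => // ->.
have pa : p != loc t a by apply: contraTneq wap => ->; rewrite ltnn.
have Wm : W_pair t m by rewrite Wt Em.
exists t'; split.
- apply/edges_on4_set1; split=> [|u uw]; first by rewrite lt' eq_sym (negbTE aw).
  rewrite lt'; case: eqP => // [_|_]; last exact: tE.
  by case: akp ok => -[_ ->]; case: (k) => //= k'; rewrite ?negbK.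
- apply/andP; split; first by apply: contraNneq pa => tt; rewrite tt lt' !eqxx.
  apply/existsP; exists m; rewrite Wm /=; apply/existsP; exists a.
  by rewrite am tt' eqxx orbT.
- exact: rank_ltn lt' wap.
move=> t'' /edges_on4_set1[w7'' _] /andP[tt'' /existsP[m' /andP[]]].
rewrite Wt -Em => /eqP/val_inj -> /existsP[u /andP[]].
rewrite in_edges om => /orP[] /eqP ->.
  by rewrite tt' eq_sym (negbTE tt'') => /eqP.
by case/orP=> /eqP E; move: w7''; rewrite E ?loc_back ?loc_fwd inE eqxx lmw.
Qed.

Lemma edges_on4_one_edge : edges_on4 [set w] s.
Proof.
apply/edges_on4_set1; rewrite loc_one_edge eqxx eq_sym (negbTE v_neq_w).
by split=> // u uw; rewrite loc_one_edge (negbTE uw); case: ifP.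
Qed.

Lemma num_upper_paths_one_edge t : num_upper_paths t s = edges_on4 [set w] t.
Proof.
have sw := edges_on4_one_edge.
have sN t' : ~~ upper_step s t'.
  apply/negP=> /andP[_ /existsP[m /andP[Wm _]]].
  by case/existsP: crit_s; exists m; rewrite Wm.
apply: (sum_npaths (P := edges_on4 [set w]) (r := rank)) => //; last exact: next_step.
(* Backward closure: the source of a step already has [w] on edge 4, and it has as many edge labels
   as the target, namely one. *)
move=> x y xy; rewrite /edges_on4 !sub1set => /andP[/eqP yE /(upper_step_yset4 xy) w4].
rewrite w4 andbT eq_sym eqEcard sub1set (upper_step_edges xy) yE !cards1 leqnn.
by rewrite in_edges; move: w4; rewrite in_yset => /eqP ->.
Qed.

End OneEdge.

Local Open Scope ring_scope.

(** * The cochains e_D, their cup products and the dual cocycles *)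

Section Cochains.
Variable n : nat.
Implicit Types (s t m : cell n) (A B D U : {set 'I_n}) (a b c : cochain n).

Definition edge4_cochain D : cochain n := [ffun s => (edges_on4 D s)%:R].

Lemma edge4_cochain0 : edge4_cochain set0 = 1.
Proof. by apply/ffunP=> s; rewrite !ffunE /edges_on4 sub0set andbT. Qed.

Lemma yset4_back U s : yset 4 (back U s) = yset 4 s :\: U.
Proof.
apply/setP=> u; rewrite !inE !in_yset loc_back.
by case: (u \in U) => //=; case: ifP => // o; move: (loc_lt8 s u); rewrite /Y /=; lia.
Qed.

Lemma yset4_fwd U s : yset 4 (fwd U s) = yset 4 s :\: U.
Proof.
apply/setP=> u; rewrite !inE !in_yset loc_fwd.
by case: (u \in U) => //=; case: ifP => // o; move: (loc_lt8 s u); rewrite /Y /=; lia.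
Qed.

(** In the cup product the first face keeps exactly the directions in [U] and the second exactly
    those outside, so only the term [U = A] can survive. *)
Lemma edge4_cochainM A B : [disjoint A & B] ->
  edge4_cochain A * edge4_cochain B = edge4_cochain (A :|: B).
Proof.
move=> dAB; apply/ffunP=> s; rewrite [LHS]ffunE [RHS]ffunE.
have EU U : U \subset edges s ->
    edge4_cochain A (back (edges s :\: U) s) * edge4_cochain B (fwd U s)
    = ((U == A) && edges_on4 (A :|: B) s)%:R.
  move=> UE; rewrite !ffunE -natrM mulnb /edges_on4 edges_back edges_fwd.
  rewrite yset4_back yset4_fwd setDDr setDv set0U (setIidPr UE).
  have [UA|//] /= := eqVneq U A; rewrite {U}UA in UE *.
  have AEA : [disjoint A & edges s :\: A].
    by rewrite disjoint_sym disjoints_subset subsetDr.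
  rewrite !subsetD subUset AEA [[disjoint B & A]]disjoint_sym dAB !andbT.
  have -> : (edges s :\: A == B) = (edges s == A :|: B).
    apply/eqP/eqP => [<-|->]; first by rewrite -{1}(setIidPr UE) setID.
    by rewrite setDUl setDv set0U; apply/setDidPl; rewrite disjoint_sym.
  by rewrite andbCA.
rewrite (eq_bigr _ EU).
have [AE|AE] := boolP (A \subset edges s).
  rewrite (bigD1 A) //= eqxx big1 ?addr0 // => U /andP[_ UA].
  by rewrite (negbTE UA).
have -> : edges_on4 (A :|: B) s = false.
  by apply: contraNF AE => /andP[/eqP -> _]; apply: subsetUl.
by rewrite big1 // => U _; rewrite andbF.
Qed.

(** The two opposite faces in a direction have the same edge labels, on edge 4 and overall, so their
    values cancel mod 2. *)
Lemma coboundary_edge4_cochain D : coboundary (edge4_cochain D) = 0.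
Proof.
apply/ffunP=> s; rewrite ffunE [RHS]ffunE big1 // => u _; rewrite !ffunE.
rewrite /edges_on4 edges_back edges_fwd yset4_back yset4_fwd.
by apply: addrr_pchar2; rewrite pchar_Fp.
Qed.

Lemma dual_cocycle_one_edge (hn : (4 <= n)%N) s (v w : 'I_n) (Z : {set 'I_n}) :
  critical s ->
  entries s = [tuple set0; set0; set0; set0; [set v]; set0; Z; [set w]] ->
  dual_cocycle s = edge4_cochain [set w].
Proof.
move=> cs Es; apply/ffunP=> t; rewrite !ffunE !cell_dimE.
rewrite (num_upper_paths_one_edge hn cs Es).
have /andP[/eqP -> _] := edges_on4_one_edge Es; case: eqP => // tw.
by rewrite /edges_on4; case: eqP tw => // ->.
Qed.

Lemma num_upper_paths_top s t : #|edges s| = (n - 2)%N -> #|edges t| = #|edges s| ->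
  num_upper_paths t s = (t == s).
Proof.
move=> sE tE; apply: sum_npaths_end => y; apply/negP=> /andP[_ /existsP[m /andP[Wm _]]].
(* A step from [t] would need a cell with [n - 1] labels on edges. *)
by have := card_edges m; rewrite (W_pair_edges Wm) tE sE ltnn.
Qed.

Lemma dual_cocycle_top s : #|edges s| = (n - 2)%N ->
  dual_cocycle s = [ffun t => (t == s)%:R].
Proof.
move=> sE; apply/ffunP=> t; rewrite !ffunE !cell_dimE; case: eqP => [tE|ts].
  by rewrite num_upper_paths_top.
by case: eqP ts => // ->.
Qed.

Lemma coboundary_dual_cocycle_top s : #|edges s| = (n - 2)%N ->
  coboundary (dual_cocycle s) = 0.
Proof.
move=> sE; rewrite dual_cocycle_top //; apply/ffunP=> t; rewrite ffunE [RHS]ffunE.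
rewrite big1 // => u ut; rewrite !ffunE.
have H t' : edges t' = edges t :\ u -> (t' == s) = false.
  move=> t'E; apply/eqP=> ts; have := card_edges t.
  by rewrite (cardsD1 u) ut -t'E ts sE ltnn.
by rewrite !H ?edges_back ?edges_fwd // addr0.
Qed.

(** * Passing from cochains to cohomology classes *)

Definition edge4_cocycle D : cocycle n :=
  Cocycle (introT eqP (coboundary_edge4_cochain D)).

Lemma coclassE (z : cocycle n) : coclass (val z) = \pi_(cohomology n)%qT z.
Proof. by rewrite /coclass valKd. Qed.

(** Both cochains must be cocycles, because [coclass] sends every other cochain to 0. *)
Lemma coclassD (x y : cochain n) : coboundary x = 0 -> coboundary y = 0 ->
  coclass x + coclass y = coclass (x + y).
Proof.
move=> /eqP dx /eqP dy; pose cx : cocycle n := Cocycle dx.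
pose cy : cocycle n := Cocycle dy.
transitivity (coclass (val cx) + coclass (val cy)) => //.
by rewrite !coclassE pi_cohomD -coclassE raddfD.
Qed.

Lemma prod_coclass (I : Type) (r : seq I) (z : I -> cocycle n) :
  \prod_(i <- r) coclass (val (z i)) = coclass (\prod_(i <- r) val (z i)).
Proof.
have -> : \prod_(i <- r) val (z i) = val (\prod_(i <- r) z i) by rewrite rmorph_prod.
rewrite coclassE; elim: r => [|i r IH]; first by rewrite !big_nil.
by rewrite !big_cons IH coclassE -pi_cohom_mul.
Qed.

Lemma prod_edge4_cochain (I : eqType) (r : seq I) (w : I -> 'I_n) :
  uniq (map w r) ->
  \prod_(i <- r) edge4_cochain [set w i] = edge4_cochain [set:: map w r].
Proof.
elim: r => [|i r IH] /=; first by rewrite big_nil set_nil edge4_cochain0.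
case/andP=> wi ur; rewrite big_cons IH // edge4_cochainM ?set_cons //.
by rewrite disjoints1 inE.
Qed.

End Cochains.

(** * The two top cells with y_4 = D, and the product formula *)

Lemma loc_top n (s : cell n) (a c : 'I_n) (D : {set 'I_n}) :
  entries s = [tuple set0; set0; set0; set0; [set a]; set0; [set c]; D] ->
  forall u, loc s u = if u == a then 4 else if u == c then 6 else 7.
Proof.
move=> Es u.
have H k : (u \in nth set0 [tuple set0; set0; set0; set0; [set a]; set0; [set c]; D] k)
   = (loc s u == k) by rewrite -in_entry Es.
have [ua|ua] := eqVneq u a; first by apply/eqP; rewrite -H /= ua inE.
have [uc|uc] := eqVneq u c; first by apply/eqP; rewrite -H /= uc inE.
have := loc_lt8 s u; have := H (loc s u); rewrite eqxx.
case: (loc s u) => [|[|[|[|[|[|[|[|//]]]]]]]] //=; rewrite ?inE //.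
  by rewrite (negbTE ua).
by rewrite (negbTE uc).
Qed.

(** Only [a] and [c] are left for vertices 3 and 4, both of which must be occupied, so there are two
    ways to place them. The exclusive or anticipates the sum of indicators in ['F_2]. *)
Lemma edges_on4_top n (t s1 s2 : cell n) (a c : 'I_n) (D : {set 'I_n}) :
  [set a; c] = ~: D ->
  entries s1 = [tuple set0; set0; set0; set0; [set a]; set0; [set c]; D] ->
  entries s2 = [tuple set0; set0; set0; set0; [set c]; set0; [set a]; D] ->
  edges_on4 D t = (t == s1) (+) (t == s2).
Proof.
move=> acD /loc_top l1 /loc_top l2.
have ac : a != c.
  have [u] := occupied4 s1; rewrite l1; have [|ua] := eqVneq u a; first by [].
  by have [<-|//] := eqVneq u c; rewrite eq_sym.
have inD u : (u \in D) = (u != a) && (u != c).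
  by rewrite -[D]setCK -acD !inE negb_or.
have top s x y : x != y -> [set x; y] = [set a; c] ->
    (forall u, loc s u = if u == x then 4 else if u == y then 6 else 7) ->
    edges_on4 D s.
  move=> xy xyE ls; rewrite /edges_on4.
  have sD u : (u \in D) = (loc s u == 7).
    rewrite inD -negb_or -(in_set2 u) -xyE !inE ls.
    by case: (u == x); case: (u == y).
  apply/andP; split; last by apply/subsetP=> u; rewrite sD in_yset.
  apply/eqP/setP=> u; rewrite sD in_edges ls.
  by case: (u == x); case: (u == y).
have [->|t1] := eqVneq t s1.
  rewrite (top _ _ _ ac erefl l1); case: eqP => // s12.
  by have := l1 a; rewrite s12 l2 eqxx (negbTE ac).
have [->|t2] := eqVneq t s2.
  by rewrite (top s2 c a) 1?eq_sym // setUC.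
apply/negP=> /andP[/eqP tD /subsetP tD4].
have nD u k : loc t u = k -> ~~ odd k -> (u == a) || (u == c).
  by move=> <-; rewrite -in_edges tD inD negb_and !negbK.
have t7 u : u != a -> u != c -> loc t u = 7.
  by move=> ua uc; apply/eqP; rewrite -(in_yset 4) tD4 // inD ua.
have [[x x4] [y y6]] := (occupied3 t, occupied4 t).
case/orP: (nD x _ x4 isT) (nD y _ y6 isT) => /eqP xE /orP[] /eqP yE.
- by rewrite xE -yE y6 in x4.
- case/eqP: t1; apply: locP => u; rewrite l1.
  have [->|ua] := eqVneq u a; first by rewrite -xE.
  by have [->|uc] := eqVneq u c; [rewrite -yE | apply: t7].
- case/eqP: t2; apply: locP => u; rewrite l2.
  have [->|uc] := eqVneq u c; first by rewrite -xE.
  by have [->|ua] := eqVneq u a; [rewrite -yE | apply: t7].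
- by rewrite xE -yE y6 in x4.
Qed.

Lemma edges_top n (s : cell n) (A C D : {set 'I_n}) :
  entries s = [tuple set0; set0; set0; set0; A; set0; C; D] -> edges s = D.
Proof.
move=> Es; apply/setP=> u; rewrite in_edges.
have H k : (u \in nth set0 [tuple set0; set0; set0; set0; A; set0; C; D] k)
   = (loc s u == k) by rewrite -in_entry Es.
have -> : (u \in D) = (loc s u == 7) := H 7.
move: (H (loc s u)) (loc_lt8 s u); rewrite eqxx.
by case: (loc s u) => [|[|[|[|[|[|[|[|]]]]]]]] //=; rewrite inE.
Qed.

(* For n = 3 the product has the single factor sigma_1, which is one of the two
   (linearly independent) summands on the right, so the identity fails there. *)
Theorem theorem4p5 (n : nat) (hn : (4 <= n)%N)
    (sigma : 'I_(n - 2) -> cell n)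
    (v w : 'I_(n - 2) -> 'I_n) (Z : 'I_(n - 2) -> {set 'I_n})
    (A C D : {set 'I_n}) (sAC sCA : cell n) :
  injective sigma ->
  (forall i, critical (sigma i)) ->
  (forall i, cell_dim (sigma i) = 1%N) ->
  (forall i, entries (sigma i) =
     [tuple set0; set0; set0; set0; [set v i]; set0; Z i; [set w i]]) ->
  D = [set w i | i : 'I_(n - 2)] ->
  #|A| = 1%N -> #|C| = 1%N -> A :|: C = [set: 'I_n] :\: D ->
  entries sAC = [tuple set0; set0; set0; set0; A; set0; C; D] ->
  entries sCA = [tuple set0; set0; set0; set0; C; set0; A; D] ->
  \prod_(i < n - 2) dual_class (sigma i) = dual_class sAC + dual_class sCA.
Proof.
move=> sigma_inj crit _ Es DE /eqP/cards1P[a ->] /eqP/cards1P[c ->] acD EAC ECA.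
(* Each [v i] is the largest label other than [w i], so [w i] determines [sigma i], and distinct
   cells have distinct [w i]. *)
have w_inj : injective w.
  move=> i j wij; apply: sigma_inj; apply: locP => u.
  rewrite (loc_one_edge (Es i)) (loc_one_edge (Es j)) wij.
  suff -> : v i = v j by [].
  apply/val_inj/eqP; rewrite eqn_leq.
  rewrite (critical_max hn (crit j) (Es j)) ?(critical_max hn (crit i) (Es i)) //.
    by rewrite wij (v_neq_w (Es j)).
  by rewrite -wij (v_neq_w (Es i)).
(* Injectivity of [w] gives [D] the size that puts [sAC] and [sCA] in the top dimension. *)
have cardD : #|D| = (n - 2)%N by rewrite DE card_imset // card_ord.
have topAC : #|edges sAC| = (n - 2)%N by rewrite (edges_top EAC).
have topCA : #|edges sCA| = (n - 2)%N by rewrite (edges_top ECA).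
rewrite /dual_class coclassD ?coboundary_dual_cocycle_top //.
transitivity (\prod_(i < n - 2) coclass (val (edge4_cocycle [set w i]))).
  by apply: eq_bigr => i _; rewrite (dual_cocycle_one_edge hn (crit i) (Es i)).
rewrite prod_coclass prod_edge4_cochain; last first.
  by rewrite map_inj_uniq // index_enum_uniq.
have -> : [set:: [seq w i | i <- index_enum 'I_(n - 2)]] = D.
  apply/setP=> u; rewrite inE DE; apply/mapP/imsetP => -[i _ ->]; exists i => //.
  exact: mem_index_enum.
congr coclass; apply/ffunP=> t; rewrite !dual_cocycle_top // !ffunE.
(* Both sides are now cochains and are compared cell by cell: e_D against the sum of two
   indicators. *)
rewrite (edges_on4_top t _ EAC ECA); last by rewrite acD setTD.
by case: (t == sAC); case: (t == sCA); apply/val_inj.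
Qed.
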